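(* Let $x\le y$ in $\mathcal{P}(n;\epsilon)$ and let $\mathcal{E}^{\times}(y\backslash x)=\{(j,k)\notin\mathcal{E}(x): (i,k),(j,l)\in\mathcal{E}(y)\text{ for some } i<j<k<l\}$. Then the Möbius function of $\mathcal{P}(n;\epsilon)$ satisfies $\mu(x,y)=0$ if $\mathcal{E}^{\times}(y\backslash x)\neq\emptyset$, and $\mu(x,y)=(-1)^{\rho(y)-\rho(x)}$ otherwise.
   Context: A network on $n$ points is a set $E$ of pairs $(i,j)$ with $1\le i<j\le n$ (directed edges; $i$ a source, $j$ a sink) with no $(i,j),(j,k)\in E$, satisfying (B1): if $(i,k),(j,l)\in E$ with $i<j<k<l$ then $(j,k)\in E$. Let $\epsilon\in\{1,0,-1\}^n$ have first nonzero entry (if any) equal to $1$; $\mathcal{N}(n;\epsilon)$ is the set of such networks in which every source $i$ has $\epsilon_i=1$ and every sink $j$ has $\epsilon_j=-1$. $\mathcal{E}(x)$ is the edge set of $x$, $\rho(x)=|\mathcal{E}(x)|$; $x\lessdot y$ iff $\rho(y)=\rho(x)+1$ and $\mathcal{E}(x)\subset\mathcal{E}(y)$; $x\le y$ iff there is a chain of covers from $x$ to $y$; $\mathcal{P}(n;\epsilon)=(\mathcal{N}(n;\epsilon),\le)$. The Möbius function is defined by $\mu(x,x)=1$ and $\mu(x,y)=-\sum_{x\le z<y}\mu(x,z)$ for $x<y$. *)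

(* Defs.v *)
From HB Require Import structures.
From mathcomp Require Import all_boot all_order all_algebra.

Set Implicit Arguments.
Unset Strict Implicit.
Unset Printing Implicit Defensive.

Import Order.TTheory GRing.Theory Num.Theory.
Local Open Scope ring_scope.

Section Mobius.
Context {d : Order.disp_t} {T : finPOrderType d}.

(* Structural recursion on a bound k; mobiusxx and mobius_lt below show that
   the bound used in mobius is large enough for the defining recursion to hold
   on the whole poset. *)
Fixpoint mobius_rec (k : nat) (x y : T) : int :=
  if x == y then 1
  else if k is k'.+1 then
    - \sum_(z : T | (x <= z)%O && (z < y)%O) mobius_rec k' x z
  else 0.

Definition mobius (x y : T) : int := mobius_rec #|T| x y.

Lemma mobius_rec_stable k1 k2 (x y : T) :
  (#|[pred z | (z < y)%O]| <= k1)%N -> (#|[pred z | (z < y)%O]| <= k2)%N ->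
  mobius_rec k1 x y = mobius_rec k2 x y.
Proof.
have below0 (u : T) : (#|[pred z | (z < u)%O]| <= 0)%N ->
    forall z, (z < u)%O = false.
  by rewrite leqn0 => /eqP/card0_eq u0 z; have := u0 z; rewrite inE.
have lt_below (u v : T) : (u < v)%O ->
    (#|[pred z | (z < u)%O]| < #|[pred z | (z < v)%O]|)%N.
  move=> uv; apply/proper_card/properP; split.
    by apply/subsetP => z; rewrite !inE => /lt_trans; apply.
  by exists u; rewrite !inE ?ltxx.
elim: k1 k2 y => [|k1 IH] [|k2] y h1 h2 //=; case: ifP => // _.
- by rewrite big_pred0 ?oppr0 // => z; rewrite below0 ?andbF.
- by rewrite big_pred0 ?oppr0 // => z; rewrite below0 ?andbF.
congr (- _); apply: eq_bigr => z /andP[_ /lt_below zy].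
by apply: IH; rewrite -ltnS; apply: leq_trans zy _.
Qed.

Lemma mobiusxx (x : T) : mobius x x = 1.
Proof. by rewrite /mobius; case: #|T| => [|k] /=; rewrite eqxx. Qed.

Lemma mobius_lt (x y : T) : (x < y)%O ->
  mobius x y = - \sum_(z : T | (x <= z)%O && (z < y)%O) mobius x z.
Proof.
move=> xy; rewrite {1}(_ : mobius x y = mobius_rec #|T|.+1 x y); last first.
  by apply: mobius_rec_stable; rewrite ?(leqW (max_card _)) ?max_card.
by rewrite /= lt_eqF.
Qed.

End Mobius.

Section Network.
Variable n : nat.

Definition is_network (E : {set 'I_n * 'I_n}) : bool :=
  [&& [forall i : 'I_n, forall j : 'I_n, ((i, j) \in E) ==> (i < j)%N],
      [forall i : 'I_n, forall j : 'I_n, forall k : 'I_n,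
        ~~ (((i, j) \in E) && ((j, k) \in E))] &
      [forall i : 'I_n, forall j : 'I_n, forall k : 'I_n, forall l : 'I_n,
        [&& (i < j)%N, (j < k)%N, (k < l)%N, (i, k) \in E & (j, l) \in E]
          ==> ((j, k) \in E)]].

Definition sign_vector (eps : 'I_n -> int) : Prop :=
  (forall i, eps i \in [:: 1; 0; -1]) /\
  (forall i, eps i != 0 -> (forall j : 'I_n, (j < i)%N -> eps j = 0) ->
     eps i = 1).

Definition compatible (eps : 'I_n -> int) (E : {set 'I_n * 'I_n}) : bool :=
  [forall i : 'I_n, forall j : 'I_n,
    ((i, j) \in E) ==> (eps i == 1) && (eps j == -1)].

Record network (eps : 'I_n -> int) := Network {
  edges : {set 'I_n * 'I_n};
  _ : is_network edges && compatible eps edges }.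

End Network.

HB.instance Definition _ n (eps : 'I_n -> int) :=
  [isSub for @edges n eps].
HB.instance Definition _ n (eps : 'I_n -> int) :=
  [Finite of network eps by <:].

Definition rho n (eps : 'I_n -> int) (x : network eps) : nat := #|edges x|.

Definition net_cover n (eps : 'I_n -> int) : rel (network eps) :=
  fun x y => (rho y == (rho x).+1) && (edges x \subset edges y).

Definition net_le n (eps : 'I_n -> int) : rel (network eps) :=
  connect (@net_cover n eps).

Section NetworkOrder.
Variables (n : nat) (eps : 'I_n -> int).

Lemma net_le_sub (x y : network eps) :
  net_le x y -> edges x \subset edges y.
Proof.
case/connectP => p; elim: p x => [|z p IH] x /=; first by move=> _ ->.
by case/andP => /andP[_ xz] /IH h /h; apply: subset_trans.
Qed.

Lemma net_le_refl : reflexive (@net_le n eps).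
Proof. by move=> x; apply: connect0. Qed.

Lemma net_le_anti : antisymmetric (@net_le n eps).
Proof.
move=> x y /andP[/net_le_sub xy /net_le_sub yx].
by apply/val_inj/eqP; rewrite /= eqEsubset xy yx.
Qed.

Lemma net_le_trans : transitive (@net_le n eps).
Proof. by move=> y x z; apply: connect_trans. Qed.

End NetworkOrder.

Fact net_display : Order.disp_t. Proof. exact: Order.Disp tt tt. Qed.

HB.instance Definition _ n (eps : 'I_n -> int) :=
  Order.Le_isPOrder.Build net_display (network eps)
    (@net_le_refl n eps) (@net_le_anti n eps) (@net_le_trans n eps).

Definition crossing_edges n (eps : 'I_n -> int) (y x : network eps) :
    {set 'I_n * 'I_n} :=
  [set p | (p \notin edges x) &&
    [exists i : 'I_n, exists l : 'I_n,
      [&& (i < p.1)%N, (p.1 < p.2)%N, (p.2 < l)%N,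
          (i, p.2) \in edges y & (p.1, l) \in edges y]]].

(* Main.v *)
Require Import Defs.
From mathcomp Require Import all_boot all_order all_algebra.
From mathcomp Require Import zify.

Import Order.TTheory GRing.Theory Num.Theory.
Local Open Scope ring_scope.

(** An interval [x, y] consists of the sets between E(x) and E(y) that are
    closed under (B1).  The candidate g(z), equal to (-1)^(rho z - rho x) when
    E^x(z \ x) is empty and to 0 otherwise, is the Möbius function as soon as
    its sum over [x, y] vanishes for x < y.  The edge (j, k) forced by a
    crossing pair (i, k), (j, l) is shorter than both of them; hence a shortest
    element of E^x(y \ x) (or any edge of y outside x if there is none) lies in
    no crossing pair that forces an edge outside x.  Adding or removing this
    edge is a sign-reversing involution on the support of g in [x, y]. *)

Definition crossing_closed {n} (A : {set 'I_n * 'I_n}) : Prop :=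
  forall i j k l : 'I_n, (i < j)%N -> (j < k)%N -> (k < l)%N ->
    (i, k) \in A -> (j, l) \in A -> (j, k) \in A.

(** Quantifying over crossing pairs of the upper end [y] covers every network of the interval at
    once. *)
Definition isolated_edge {n} (x y : {set 'I_n * 'I_n}) (e : 'I_n * 'I_n) : Prop :=
  forall i j k l : 'I_n, (i < j)%N -> (j < k)%N -> (k < l)%N ->
    (i, k) \in y -> (j, l) \in y -> (i, k) = e \/ (j, l) = e -> (j, k) \in x.

Definition toggle {T : finType} (e : T) (A : {set T}) : {set T} :=
  if e \in A then A :\ e else e |: A.

Lemma toggleK (T : finType) (e : T) : involutive (toggle e).
Proof.
move=> A; rewrite /toggle; case eA: (e \in A).
  by rewrite setD11 setD1K.
by rewrite setU11 setU1K // eA.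
Qed.

Section Networks.
Context {n : nat} {eps : 'I_n -> int}.
Implicit Types (x y z : network eps) (A : {set 'I_n * 'I_n}).

Lemma edges_closed x : crossing_closed (edges x).
Proof.
case: x => A /= /andP[/and3P[_ _ hA] _] i j k l ij jk kl ik jl.
move: hA => /forallP/(_ i)/forallP/(_ j)/forallP/(_ k)/forallP/(_ l).
by rewrite ij jk kl ik jl.
Qed.

(** Apart from (B1), every requirement only restricts the edges that are present, so it passes to
    subsets. *)
Lemma closed_subset_network y A : A \subset edges y -> crossing_closed A ->
  is_network A && compatible eps A.
Proof.
case: y => B /= /andP[/and3P[hlt hbip _] hc] /subsetP sAB cA.
apply/andP; split; last first.
  apply/forallP => i; apply/forallP => j; apply/implyP => /sAB.
  by move: hc => /forallP/(_ i)/forallP/(_ j)/implyP.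
apply/and3P; split.
- apply/forallP => i; apply/forallP => j; apply/implyP => /sAB.
  by move: hlt => /forallP/(_ i)/forallP/(_ j)/implyP.
- apply/forallP => i; apply/forallP => j; apply/forallP => k.
  move: hbip => /forallP/(_ i)/forallP/(_ j)/forallP/(_ k).
  by apply: contra => /andP[/sAB -> /sAB ->].
- apply/forallP => i; apply/forallP => j; apply/forallP => k.
  apply/forallP => l; apply/implyP => /and5P[ij jk kl ik jl].
  exact: cA ik jl.
Qed.

Lemma insubd_edges z y A : A \subset edges y -> crossing_closed A ->
  edges (insubd z A) = A.
Proof. by move=> sAy cA; apply/insubdK/(closed_subset_network _ _ sAy cA). Qed.

(* A shortest missing edge can always be added: any edge it would force is
   shorter still. *)
Lemma net_leE x y : (x <= y)%O = (edges x \subset edges y).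
Proof.
apply/idP/idP; first exact: net_le_sub.
have [m] := ubnP #|edges y :\: edges x|.
elim: m => // m IH in x *; rewrite ltnS => hm sxy.
have [/eqP|[p0 p0D]] := set_0Vmem (edges y :\: edges x).
  rewrite setD_eq0 => syx.
  by have -> : x = y by apply/val_inj/eqP; rewrite /= eqEsubset sxy.
have [e + emin] := @arg_minnP _ p0 (mem (edges y :\: edges x))
  (fun p => (p.2 - p.1)%N) p0D.
rewrite /= in_setD => /andP[ex ey].
have cA : crossing_closed (e |: edges x).
  move=> i j k l ij jk kl ik jl.
  have inA p : p \in e |: edges x -> p \in edges y.
    by case/setU1P => [->//|]; apply: (subsetP sxy).
  have jky := edges_closed _ _ _ _ _ ij jk kl (inA _ ik) (inA _ jl).
  apply/setU1P; right; apply: contraT => jkx.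
  have := emin (j, k); rewrite /= in_setD jkx jky => /(_ isT).
  case/setU1P: ik => [<- /=|ik]; first lia.
  case/setU1P: jl => [<- /=|jl]; first lia.
  by rewrite (edges_closed _ _ _ _ _ ij jk kl ik jl) in jkx.
have sAy : e |: edges x \subset edges y by rewrite subUset sub1set ey.
pose x' := insubd x (e |: edges x).
have ex' : edges x' = e |: edges x by apply: (insubd_edges _ _ _ sAy cA).
apply: (@le_trans _ _ x').
  by apply: connect1; rewrite /net_cover /rho ex' cardsU1 ex subsetUr eqxx.
apply: IH; rewrite ex' //; apply: leq_trans hm.
rewrite (cardsD1 e (edges y :\: edges x)) in_setD ex ey add1n ltnS.
by apply/subset_leq_card/subsetP => p; rewrite !inE negb_or andbA.
Qed.

(** Emptiness becomes a closure property relative to [x]; in the case [x = y] it is (B1) itself. *)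
Lemma crossing_edges_eq0 x y : crossing_edges y x = set0 <->
  forall i j k l : 'I_n, (i < j)%N -> (j < k)%N -> (k < l)%N ->
    (i, k) \in edges y -> (j, l) \in edges y -> (j, k) \in edges x.
Proof.
split=> [h i j k l ij jk kl ik jl|h].
  apply: contraT => jkx; have := in_set0 (j, k); rewrite -h inE /= jkx /=.
  by move/existsP; case; exists i; apply/existsP; exists l; apply/and5P.
apply/eqP/set0Pn => -[[j k]]; rewrite inE /= => /andP[/negP jkx].
case/existsP => i /existsP[l /and5P[ij jk kl ik jl]].
exact/jkx/(h i j k l).
Qed.

Lemma exists_isolated_edge x y : (x < y)%O ->
  exists2 e, e \in edges y :\: edges x & isolated_edge (edges x) (edges y) e.
Proof.
move=> xy; have [cr0|[p0 p0cr]] := set_0Vmem (crossing_edges y x).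
  have [/eqP|[e eD]] := set_0Vmem (edges y :\: edges x).
    by rewrite setD_eq0 -net_leE => /(lt_le_trans xy); rewrite ltxx.
  exists e => // i j k l ij jk kl ik jl _.
  exact: (iffLR (crossing_edges_eq0 x y) cr0 i j k l).
have [[j0 k0] + emin] := @arg_minnP _ p0 (mem (crossing_edges y x))
  (fun p => (p.2 - p.1)%N) p0cr.
rewrite /= inE /= => /andP[ex /existsP[i0 /existsP[l0]]].
move=> /and5P[ij0 jk0 kl0 ik0 jl0].
exists (j0, k0).
  (* (B1) for [y] puts the forced edge in [y]. *)
  by rewrite in_setD ex (edges_closed _ _ _ _ _ ij0 jk0 kl0 ik0 jl0).
move=> i j k l ij jk kl ik jl he; apply: contraT => jkx.
have jkcr : (j, k) \in crossing_edges y x.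
  rewrite inE /= jkx; apply/existsP; exists i; apply/existsP; exists l.
  exact/and5P.
have := emin _ jkcr; rewrite /=.
by case: he => -[<- <-]; lia.
Qed.

Definition mobius_guess x z : int :=
  if crossing_edges z x == set0 then (-1) ^+ (rho z - rho x) else 0.

(** A crossing pair of the toggled set either contains [e], and isolation applies, or lies in [z],
    and the hypothesis on [z] applies. Either way the forced edge is in [x], hence in the toggled
    set, since [e] is not an edge of [x]. This gives both (B1) and the absence of crossing edges. *)
Lemma toggle_edges x y z e :
  e \in edges y :\: edges x -> isolated_edge (edges x) (edges y) e ->
  (x <= z <= y)%O -> crossing_edges z x = set0 ->
  let z' := insubd z (toggle e (edges z)) in
  [/\ edges z' = toggle e (edges z), (x <= z' <= y)%O
    & crossing_edges z' x = set0].
Proof.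
rewrite in_setD => /andP[ex ey] eiso; rewrite !net_leE => /andP[sxz szy].
move=> /crossing_edges_eq0 hz z'; set A := toggle e (edges z).
have sxA : edges x \subset A.
  rewrite /A /toggle; case: ifP => _; first by rewrite subsetD1 sxz.
  exact: subset_trans sxz (subsetUr _ _).
have AzE p : p \in A -> p = e \/ p \in edges z.
  rewrite /A /toggle; case: ifP => _; last by case/setU1P; [left | right].
  by case/setD1P; right.
have inAy p : p \in A -> p \in edges y.
  by case/AzE => [->//|]; apply: (subsetP szy).
have hA (i j k l : 'I_n) : (i < j)%N -> (j < k)%N -> (k < l)%N ->
    (i, k) \in A -> (j, l) \in A -> (j, k) \in edges x.
  move=> ij jk kl ik jl; have := eiso i j k l ij jk kl (inAy _ ik) (inAy _ jl).
  case/AzE: ik => [->|ik]; first by apply; left.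
  case/AzE: jl => [->|jl _]; first by apply; right.
  exact: (hz i j k l).
have sAy : A \subset edges y by apply/subsetP.
have cA : crossing_closed A.
  by move=> i j k l ij jk kl ik jl; apply/(subsetP sxA)/(hA i j k l).
have ez' : edges z' = A by apply: (insubd_edges _ _ _ sAy cA).
by split=> //; [rewrite !net_leE ez' sxA sAy | apply/crossing_edges_eq0; rewrite ez'].
Qed.

(** Toggling changes the rank by one; the two bounds by [x] keep the truncated subtractions
    exact. *)
Lemma rho_toggle_sign x z z' e : (x <= z)%O -> (x <= z')%O ->
  edges z' = toggle e (edges z) ->
  (-1) ^+ (rho z' - rho x) = - (-1) ^+ (rho z - rho x) :> int.
Proof.
rewrite !net_leE => /subset_leq_card xz /subset_leq_card xz' ez'.
have : rho z = (rho z').+1 \/ rho z' = (rho z).+1.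
  rewrite /rho ez' /toggle; case: ifP => eA.
    by left; rewrite (cardsD1 e (edges z)) eA.
  by right; rewrite cardsU1 eA.
by case=> ->; rewrite subSn // exprS mulN1r ?opprK.
Qed.

Lemma sum_mobius_guess x y : (x < y)%O ->
  \sum_(z | (x <= z <= y)%O) mobius_guess x z = 0.
Proof.
move=> xy; have [e eD eiso] := exists_isolated_edge _ _ xy.
(* The test in [mobius_guess] moves into the index condition, so [S] runs only over networks without
   crossing edges. *)
rewrite -big_mkcondr /=; set S := \sum_(z | _) _.
(* The default [z] is never taken when [P z] holds, by [toggle_edges]. *)
pose h z : network eps := insubd z (toggle e (edges z)).
pose P z := (x <= z <= y)%O && (crossing_edges z x == set0).
have hP z : P z -> edges (h z) = toggle e (edges z) /\ P (h z).
  case/andP => xzy /eqP cz.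
  have [-> le_hz cr_hz] := toggle_edges _ _ _ _ eD eiso xzy cz.
  by split=> //; rewrite /P le_hz cr_hz /=.
have hK z : P z -> h (h z) = z.
  move=> Pz; have [e1 Phz] := hP z Pz; have [e2 _] := hP _ Phz.
  by apply: val_inj; rewrite /= e2 e1 toggleK.
suff SN : S = - S by lia.
rewrite {1}/S (reindex_onto h h) => [|z Pz]; last exact: hK.
rewrite /S -sumrN (eq_bigl P) => [|z].
  apply: eq_bigr => z Pz; have [ez Phz] := hP z Pz.
  apply: rho_toggle_sign ez.
    by case/andP: Pz => /andP[].
  by case/andP: Phz => /andP[].
(* The reindexed condition reduces to [P z]: if [h (h z) = z], then [P (h z)] gives [P z] by one
   more application of [h]. *)
apply/andP/idP => [[Phz /eqP <-]|Pz]; first by have [] := hP _ Phz.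
by split; [have [] := hP z Pz | rewrite hK].
Qed.

(** By strong induction on [rho y]: isolating the term [z = y] in the vanishing sum gives the
    recursion satisfied by [mobius]. *)
Lemma mobiusE x y : (x <= y)%O -> mobius x y = mobius_guess x y.
Proof.
have [m] := ubnP (rho y); elim: m => // m IH in y *; rewrite ltnS => hm.
rewrite le_eqVlt => /predU1P[<-|xy].
  rewrite mobiusxx /mobius_guess subnn expr0; case: eqP => // -[].
  (* At [y = x], (B1) rules out crossing edges, so the guess is 1. *)
  by apply/crossing_edges_eq0; apply: edges_closed.
have := sum_mobius_guess _ _ xy; rewrite (bigD1 y) /= ?lexx ?ltW // => /eqP.
rewrite addr_eq0 => /eqP ->; rewrite mobius_lt //; congr (- _).
apply: eq_big => [z|z /andP[xz zy]].
  by rewrite -andbA (andbC (z <= y)%O) -lt_neqAle.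
apply: IH => //; apply: leq_trans hm.
by apply: proper_card; rewrite properE -!net_leE (ltW zy) lt_geF.
Qed.

End Networks.

Theorem theorem5p14 (n : nat) (eps : 'I_n -> int) (heps : sign_vector eps)
    (x y : network eps) (hxy : (x <= y)%O) :
  (crossing_edges y x != set0 -> mobius x y = 0) /\
  (crossing_edges y x = set0 -> mobius x y = (-1) ^+ (rho y - rho x)).
Proof.
rewrite (mobiusE _ _ hxy) /mobius_guess.
by split=> [/negPf -> | ->]; rewrite ?eqxx.
Qed.
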